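(* Assume that $k\ge 2$ and $m\ge n\ge 1$ are positive integers and $\mathcal{G}$ and $\mathcal{H}$ are $k$-uniform hypergraphs with $\alpha(\mathcal{G})\ge\alpha(\mathcal{H})$ and $R(\mathcal{G},\mathcal{H})=|V(\mathcal{G})|+|V(\mathcal{H})|-\alpha(\mathcal{H})-1$. Then $$R(m\mathcal{G},n\mathcal{H})=m|V(\mathcal{G})|+n|V(\mathcal{H})|-n\alpha(\mathcal{H})-1.$$
   Context: A $k$-uniform hypergraph $\mathcal{H}$ is a pair $(V,E)$ where $V$ is a set of vertices and $E$ is a set of $k$-subsets of $V$ (the edges). $n\mathcal{H}$ denotes $n$ disjoint copies of $\mathcal{H}$. A set of vertices is independent if it contains no edge; $\alpha(\mathcal{H})$ is the maximum size of an independent set. For $k$-uniform $\mathcal{G},\mathcal{H}$, the Ramsey number $R(\mathcal{G},\mathcal{H})$ is the smallest positive integer $N$ such that every red-blue coloring of the edges of the complete $k$-uniform hypergraph on $N$ vertices contains a red copy of $\mathcal{G}$ or a blue copy of $\mathcal{H}$.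
   Formalization: It is additionally assumed that G has no isolated vertex and that H has at least one edge; without these the claim fails, e.g. for G = K_2 + 10K_1, H = K_2, m = n = 2, or for G = K_{1,s}, H = sK_1 (s ≥ 2), m = 2, n = 1. *)

(* Defs.v *)
From mathcomp Require Import all_boot.
Set Implicit Arguments.
Unset Strict Implicit.
Unset Printing Implicit Defensive.

Record hypergraph (k : nat) := Hypergraph {
  vertex :> finType;
  edges : {set {set vertex}};
  edges_uniform : forall e, e \in edges -> #|e| = k
}.

Section Hypergraphs.
Variable k : nat.
Implicit Types F G H : hypergraph k.

Definition independent H (A : {set H}) : bool :=
  [forall e in edges H, ~~ (e \subset A)].

Definition alpha H : nat := \max_(A : {set H} | independent A) #|A|.

Definition no_isolated_vertex H : bool :=
  [forall x : H, [exists e in edges H, x \in e]].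

Definition copies_edges (n : nat) H : {set {set 'I_n * H}} :=
  [set [set (i, x) | x in (e : {set H})] | i in [set: 'I_n], e in edges H].

Lemma copies_uniform n H e : e \in copies_edges n H -> #|e| = k.
Proof.
case/imset2P=> i f _ fE ->.
by rewrite card_imset ?(edges_uniform fE) // => x y [].
Qed.

(* n disjoint copies of H; copy i lives on the vertices (i, x) *)
Definition copies n H : hypergraph k := Hypergraph (@copies_uniform n H).

(* F contains a copy of G as a (not necessarily induced) subhypergraph *)
Definition contains_copy F G : Prop :=
  exists2 f : G -> F, injective f & forall e, e \in edges G -> f @: e \in edges F.

(* A colouring is given on all sets of vertices, but only its values on the
   k-subsets, i.e. on the edges of the complete hypergraph, are ever used. *)
Definition color_edges N (c : {set 'I_N} -> bool) (b : bool) : {set {set 'I_N}} :=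
  [set e : {set 'I_N} | (#|e| == k) && (c e == b)].

Lemma color_uniform N (c : {set 'I_N} -> bool) b e :
  e \in color_edges c b -> #|e| = k.
Proof. by rewrite inE => /andP [/eqP]. Qed.

Definition color_class N (c : {set 'I_N} -> bool) b : hypergraph k :=
  Hypergraph (@color_uniform N c b).

(* true is red, false is blue *)
Definition arrows (N : nat) G H : Prop :=
  forall c : {set 'I_N} -> bool,
    contains_copy (color_class c true) G \/ contains_copy (color_class c false) H.

(* R(G, H) = N *)
Definition is_ramsey_number G H (N : nat) : Prop :=
  [/\ 0 < N, arrows N G H & forall M, 0 < M -> arrows M G H -> N <= M].

End Hypergraphs.

(* Main.v *)
Require Import Defs.
From mathcomp Require Import all_boot.
From mathcomp Require Import zify.

(** Write a = |V(G)|, d = |V(H)| - alpha(H) and r = R(G,H) = a + d - 1.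

    Lower bound: colour the edges inside a set of m a - 1 vertices red and all
    the other edges blue, with n d - 1 vertices outside that set. A red mG has
    no isolated vertices, so it does not fit; each blue H has at least d of its
    vertices outside.

    Upper bound: if there is no red G, or no blue H, blue copies of H, or red
    copies of G, can be removed greedily. Otherwise exchange vertices one at a
    time to pass from an r-set containing a red G to an r-set containing a
    blue H. Each r-set on the way contains one or the other, so two consecutive
    ones have a union, of r + 1 vertices, that contains both. Removing that
    union reduces (n + 1, n + 1) to (n, n), and removing a red G reduces
    (m + 1, n) to (m, n). *)

Set Implicit Arguments.
Unset Strict Implicit.
Unset Printing Implicit Defensive.

(** * Bounds on the independence number *)

Section Alpha.
Variable k : nat.
Implicit Types H : hypergraph k.

Lemma leq_alpha H (A : {set H}) : independent A -> #|A| <= alpha H.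
Proof. by move=> iA; apply: (@leq_bigmax_cond _ _ (fun B : {set H} => #|B|)). Qed.

Lemma alpha_ltn_card H : 0 < k -> edges H != set0 -> alpha H < #|H|.
Proof.
move=> k0 /set0Pn [e eH].
rewrite /alpha; elim/big_ind: _ => [|p q|A /forall_inP iA].
- by apply: leq_trans (max_card (mem e)); rewrite (edges_uniform eH).
- by rewrite gtn_max => -> ->.
- rewrite ltn_neqAle max_card andbT; apply/negP => /eqP cA.
  have /eqP AT : A == setT by rewrite eqEcard subsetT cardsT cA leqnn.
  by have := iA e eH; rewrite AT subsetT.
Qed.

(** A singleton is too small to contain an edge of [k >= 2] vertices. *)
Lemma alpha_gt0 H : 1 < k -> edges H != set0 -> 0 < alpha H.
Proof.
move=> k1 /set0Pn [e eH]; have ce := edges_uniform eH.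
have /card_gt0P [x _] : 0 < #|e| by rewrite ce ltnW.
rewrite -(cards1 x); apply: leq_alpha.
apply/forall_inP => f fH; apply/negP => /subset_leq_card.
by rewrite cards1 (edges_uniform fH) leqNgt k1.
Qed.

End Alpha.

(** * Monochromatic copies inside a vertex set *)

Section MonochromaticCopies.
Variables (k : nat) (T : finType) (c : {set T} -> bool).
Implicit Types (X : hypergraph k) (A B : {set T}) (b : bool).

(** A boolean form of [contains_copy] localised to [A]: vertices are removed by shrinking [A], while
    [T] and [c] stay fixed. *)
Definition mono_copy b X A : bool :=
  [exists f : {ffun X -> T}, [&& injectiveb f, [forall x, f x \in A]
    & [forall e in edges X, c (f @: (e : {set X})) == b]]].

Lemma mono_copyP b X A :
  reflect (exists f : X -> T, [/\ injective f, forall x, f x \in A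
             & forall e, e \in edges X -> c (f @: e) = b])
          (mono_copy b X A).
Proof.
apply: (iffP existsP) => [[f /and3P [/injectiveP fI /forallP fA /forall_inP fe]]|].
  by exists f; split=> // e eX; apply/eqP/fe.
case=> f [fI fA fe]; exists (finfun f); apply/and3P; split.
- by apply/injectiveP => x y; rewrite !ffunE => /fI.
- by apply/forallP => x; rewrite ffunE.
- apply/forall_inP => e eX; rewrite -(fe e eX); apply/eqP; congr c.
  by apply: eq_imset => x; rewrite ffunE.
Qed.

Lemma mono_copyS b X A B : A \subset B -> mono_copy b X A -> mono_copy b X B.
Proof.
move=> /subsetP sAB /mono_copyP [f [fI fA fe]].
by apply/mono_copyP; exists f; split=> // x; apply/sAB.
Qed.

Lemma mono_copy_support b X A : mono_copy b X A ->
  exists B, [/\ B \subset A, #|B| = #|X| & mono_copy b X B].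
Proof.
move=> /mono_copyP [f [fI fA fe]]; exists (f @: setT); split.
- by apply/subsetP => _ /imsetP [x _ ->].
- by rewrite card_imset // cardsT.
- by apply/mono_copyP; exists f; split=> // x; rewrite imset_f.
Qed.

Lemma mono_copies0 b X A : mono_copy b (copies 0 X) A.
Proof.
apply/mono_copyP; have f (p : 'I_0 * X) : T by case: p => - [].
exists f; split=> [[[]]|[[]]|e] //.
by case/imset2P=> [[]].
Qed.

Lemma mono_copiesS b X n A B : B \subset A -> mono_copy b X B ->
  mono_copy b (copies n X) (A :\: B) -> mono_copy b (copies n.+1 X) A.
Proof.
move=> /subsetP sBA /mono_copyP [f [fI fB fe]] /mono_copyP [g [gI gA ge]].
(* Copy 0 goes into [B] by [f], the others avoid [B] by [g], so the images are disjoint. *)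
pose F (p : 'I_n.+1 * X) :=
  if unlift ord0 p.1 is Some j then g (j, p.2) else f p.2.
have F0 x : F (ord0, x) = f x by rewrite /F unlift_none.
have FS j x : F (lift ord0 j, x) = g (j, x) by rewrite /F liftK.
have fg x p : f x <> g p.
  by move=> E; have := gA p; rewrite inE -E fB.
apply/mono_copyP; exists F; split.
- case=> i x [j y]; case: (unliftP ord0 i) => [i'|] ->;
    case: (unliftP ord0 j) => [j'|] ->; rewrite ?F0 ?FS.
  + by move=> /gI [-> ->].
  + by move=> /esym /fg.
  + by move=> /fg.
  + by move=> /fI ->.
- case=> i x; case: (unliftP ord0 i) => [i'|] ->; rewrite ?F0 ?FS.
  + by have := gA (i', x); rewrite inE => /andP [].
  + exact/sBA/fB.
- move=> _ /imset2P [i e _ eX ->]; rewrite -imset_comp.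
  case: (unliftP ord0 i) => [i'|] ->.
  + rewrite -(ge [set (i', x) | x in (e : {set X})]); last first.
      by apply/imset2P; exists i' e.
    by rewrite -imset_comp; congr c; apply: eq_imset => x /=; rewrite FS.
  + by rewrite -(fe e eX); congr c; apply: eq_imset => x /=; rewrite F0.
Qed.

(** Each of the first [n] copies removed costs [#|X|] vertices, so at least [r] vertices are left
    for the last one. *)
Lemma mono_copies_greedy b X r n A :
  (forall B, B \subset A -> r <= #|B| -> mono_copy b X B) ->
  r + n * #|X| <= #|A| -> mono_copy b (copies n.+1 X) A.
Proof.
elim: n A => [|n IH] A HA cA.
  apply: (mono_copiesS (subxx A)); last exact: mono_copies0.
  by apply: HA => //; lia.
have /mono_copy_support [B [sBA cB XB]] : mono_copy b X A by apply: HA => //; lia.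
apply: (mono_copiesS sBA XB); apply: IH => [D sD|].
  by apply: HA; apply: subset_trans sD (subsetDl _ _).
by rewrite cardsD (setIidPr sBA) cB; lia.
Qed.

End MonochromaticCopies.

Lemma arrows_mono_copy k N (G H : hypergraph k) (T : finType)
  (c : {set T} -> bool) (A : {set T}) :
  arrows N G H -> N <= #|A| -> mono_copy c true G A || mono_copy c false H A.
Proof.
move=> aN NA.
(* The colouring is pulled back along an injection [g] of ['I_N] into [A]. *)
pose g (i : 'I_N) : T := enum_val (widen_ord NA i).
have gI : injective g by move=> i j /enum_val_inj /(congr1 val) /= /val_inj.
have pull b (X : hypergraph k) :
    contains_copy (color_class k (fun e => c (g @: e)) b) X -> mono_copy c b X A.
  case=> f fI fe; apply/mono_copyP; exists (g \o f); split.
  - exact: inj_comp.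
  - by move=> x; apply: enum_valP.
  - move=> e eX; have := fe e eX; rewrite inE => /andP [_ /eqP <-].
    by rewrite imset_comp.
by case: (aN (fun e => c (g @: e))) => /pull ->; rewrite ?orbT.
Qed.

Lemma contains_copy_mono k N (c : {set 'I_N} -> bool) b (X : hypergraph k)
  (A : {set 'I_N}) :
  mono_copy c b X A -> contains_copy (color_class k c b) X.
Proof.
move=> /mono_copyP [f [fI _ fe]]; exists f => // e eX.
by rewrite inE card_imset // (edges_uniform eX) fe // !eqxx.
Qed.

(** * Exchanging vertices between sets of equal size *)

Lemma extend_card (T : finType) (B A : {set T}) r :
  B \subset A -> #|B| <= r <= #|A| ->
  exists D : {set T}, [/\ B \subset D, D \subset A & #|D| = r].
Proof.
move=> sBA /andP [Br rA].
have : r - #|B| <= #|A :\: B| by rewrite cardsD (setIidPr sBA) leq_sub2r.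
case/card_geqP=> s [us ss sub].
exists (B :|: [set x in s]); split; first exact: subsetUl.
  rewrite subUset sBA; apply/subsetP => x; rewrite inE => /sub.
  by rewrite inE => /andP [].
have -> : #|B :|: [set x in s]| = #|B| + #|[set x in s]|.
  apply/eqP; rewrite (leq_card_setU _ _) -setI_eq0.
  apply/eqP/setP => x; rewrite !inE; apply/negP => /andP [xB /sub].
  by rewrite inE xB.
by rewrite cardsE (card_uniqP us) ss subnKC.
Qed.

Lemma exchange_path (T : finType) (p q : pred {set T}) (A B0 B1 : {set T}) r :
  (forall B D : {set T}, B \subset D -> p B -> p D) ->
  (forall B D : {set T}, B \subset D -> q B -> q D) ->
  (forall B : {set T}, B \subset A -> #|B| = r -> p B || q B) ->
  B0 \subset A -> B1 \subset A -> #|B0| = r -> #|B1| = r -> p B0 -> q B1 ->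
  exists S : {set T}, [/\ S \subset A, #|S| <= r.+1, p S & q S].
Proof.
move=> pS qS pq sB0 sB1 cB0 cB1 pB0 qB1.
have [s] := ubnP #|B0 :\: B1|; elim: s B0 sB0 cB0 pB0 => // s IH B0 sB0 cB0 pB0 ltBs.
have [E|] := eqVneq (B0 :\: B1) set0.
  exists B1; split=> //; first by rewrite cB1.
  by apply: pS pB0; rewrite -setD_eq0 E.
case/set0Pn=> x xB; have /setDP [xB0 xB1] := xB.
have : 0 < #|B1 :\: B0|.
  have : 0 < #|B0 :\: B1| by apply/card_gt0P; exists x.
  by rewrite !cardsD setIC cB0 cB1 setIC.
case/card_gt0P=> y /setDP [yB1 yB0].
have xy : x != y by apply: contraNneq yB0 => <-.
(* This swap keeps the size [r] and brings the set one vertex closer to [B1]. If [p] survives, the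
   induction continues from [B]. *)
pose B := y |: (B0 :\ x).
have sB : B \subset A.
  rewrite subUset sub1set (subsetP sB1 _ yB1).
  exact: subset_trans (subsetDl _ _) sB0.
have cB : #|B| = r.
  by rewrite cardsU1 !inE (negPf yB0) andbF /= -cB0 [in RHS](cardsD1 x) xB0.
have [pB|npB] := boolP (p B).
  apply: (IH B) => //; apply: leq_trans (_ : _ < #|B0 :\: B1|) _ => //.
  apply: proper_card; apply/properP; split.
    apply/subsetP => z; rewrite !inE => /andP [zB1].
    by case: eqP zB1 => [->|_]; rewrite ?yB1 //= => -> /andP [_ ->].
  by exists x; rewrite // !inE eqxx (negPf xy) andbF.
have qB : q B by have := pq B sB cB; rewrite (negPf npB).
(* Here [p] has been lost, so [q B] holds; this set is the union of [B0], which has [p], and [B],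
   which has [q]. *)
exists (y |: B0); split.
- by rewrite subUset sub1set (subsetP sB1 _ yB1).
- by rewrite cardsU1 yB0 cB0.
- exact: pS (subsetUr _ _) pB0.
- by apply: qS qB; apply: setUS; apply: subsetDl.
Qed.

(** * The upper bound *)

Section UpperBound.
Variables (k : nat) (G H : hypergraph k) (d : nat).
Hypotheses (cardH : #|H| = alpha H + d) (d_gt0 : 0 < d).
Hypothesis alpha_lt : alpha H < #|G|.
Hypothesis arrowsGH : arrows (#|G| + d).-1 G H.
Variables (T : finType) (c : {set T} -> bool).
Implicit Types A S : {set T}.

(** Removing [n] blue copies costs [n * alpha H + n * d] vertices; the first term is at most
    [m * #|G|] because [n <= m] and [alpha H < #|G|]. *)
Lemma arrows_copies_no_red m n A :
  n <= m -> m.+1 * #|G| + n.+1 * d <= #|A|.+1 ->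
  ~~ mono_copy c true G A -> mono_copy c false (copies n.+1 H) A.
Proof.
move=> nm cA nG; apply: (@mono_copies_greedy _ _ _ _ _ (#|G| + d).-1) => [B sB cB|].
  have /orP [|] // := arrows_mono_copy c arrowsGH cB.
  by move=> /(mono_copyS sB); rewrite (negPf nG).
have : n * alpha H <= m * #|G| by rewrite leq_mul // ltnW.
by rewrite cardH; lia.
Qed.

Lemma arrows_copies_no_blue m n A :
  m.+1 * #|G| + n.+1 * d <= #|A|.+1 ->
  ~~ mono_copy c false H A -> mono_copy c true (copies m.+1 G) A.
Proof.
move=> cA nH; apply: (@mono_copies_greedy _ _ _ _ _ (#|G| + d).-1) => [B sB cB|].
  have /orP [|] // := arrows_mono_copy c arrowsGH cB.
  by move=> /(mono_copyS sB); rewrite (negPf nH).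
by lia.
Qed.

Lemma red_blue_overlap A : #|G| + d <= #|A|.+1 ->
  mono_copy c true G A -> mono_copy c false H A ->
  exists S, [/\ S \subset A, #|S| <= #|G| + d,
                mono_copy c true G S & mono_copy c false H S].
Proof.
move=> cA /mono_copy_support [B0 [sB0 cB0 pB0]] /mono_copy_support [B1 [sB1 cB1 qB1]].
pose r := (#|G| + d).-1.
have [D0 [sBD0 sD0 cD0]] : exists D : {set T}, [/\ B0 \subset D, D \subset A & #|D| = r].
  by apply: extend_card => //; rewrite cB0 /r; lia.
(* A copy of [H] fits in [r] vertices since [#|H| = alpha H + d] and [alpha H < #|G|]. *)
have [D1 [sBD1 sD1 cD1]] : exists D : {set T}, [/\ B1 \subset D, D \subset A & #|D| = r].
  by apply: extend_card => //; rewrite cB1 /r; lia.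
have [|||S [sS cS pS qS]] := @exchange_path _ (mono_copy c true G) (mono_copy c false H)
   A D0 D1 r _ _ _ sD0 sD1 cD0 cD1 (mono_copyS sBD0 pB0) (mono_copyS sBD1 qB1).
- by move=> B D; apply: mono_copyS.
- by move=> B D; apply: mono_copyS.
- by move=> B _ cB; apply: arrows_mono_copy arrowsGH _; rewrite cB.
by exists S; split=> //; move: cS; rewrite /r; lia.
Qed.

Lemma arrows_copies_diag n A :
  n.+1 * #|G| + n.+1 * d <= #|A|.+1 ->
  mono_copy c true (copies n.+1 G) A || mono_copy c false (copies n.+1 H) A.
Proof.
elim: n A => [|n IH] A cA.
  have /orP [GA|HA] : mono_copy c true G A || mono_copy c false H A.
  + by apply: arrows_mono_copy arrowsGH _; lia.
  + by rewrite (mono_copiesS (subxx A) GA) // mono_copies0.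
  + by rewrite orbC (mono_copiesS (subxx A) HA) // mono_copies0.
have [GA|nG] := boolP (mono_copy c true G A); last first.
  by rewrite orbC (arrows_copies_no_red _ cA).
have [HA|nH] := boolP (mono_copy c false H A); last first.
  by rewrite (arrows_copies_no_blue cA).
have [|S [sS cS GS HS]] := red_blue_overlap _ GA HA; first by lia.
(* Whichever colour the induction yields outside [S], [S] supplies one more copy in that colour. *)
have /IH /orP [IG|IH'] : n.+1 * #|G| + n.+1 * d <= #|A :\: S|.+1.
- by rewrite cardsD (setIidPr sS); lia.
- by rewrite (mono_copiesS sS GS).
- by rewrite orbC (mono_copiesS sS HS).
Qed.

(** Induction on [m] down to the diagonal [m = n]: removing a red [G] costs exactly the [#|G|]
    vertices by which the bound drops. *)
Lemma arrows_copies m n A :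
  n <= m -> m.+1 * #|G| + n.+1 * d <= #|A|.+1 ->
  mono_copy c true (copies m.+1 G) A || mono_copy c false (copies n.+1 H) A.
Proof.
elim: m A => [|m IH] A; first by rewrite leqn0 => /eqP ->; apply: arrows_copies_diag.
rewrite leq_eqVlt => /orP [/eqP <-|nm] cA; first exact: arrows_copies_diag.
have [|nG] := boolP (mono_copy c true G A); last first.
  by rewrite orbC (arrows_copies_no_red _ cA) // ltnW.
case/mono_copy_support=> S [sS cS GS].
have /IH /orP [//|IG|HS] : m.+1 * #|G| + n.+1 * d <= #|A :\: S|.+1.
- by rewrite cardsD (setIidPr sS) cS; lia.
- by rewrite (mono_copiesS sS GS).
- by rewrite orbC (mono_copyS (subsetDl A S) HS).
Qed.

End UpperBound.

(** * The lower bound *)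

Lemma copies_no_isolated_vertex k n (G : hypergraph k) :
  no_isolated_vertex G -> no_isolated_vertex (copies n G).
Proof.
move=> /forallP nG; apply/forallP => -[i x].
have /exists_inP [e eG xe] := nG x.
apply/exists_inP; exists [set (i, y) | y in (e : {set G})]; last exact: imset_f.
by apply/imset2P; exists i e.
Qed.

Section LowerBound.
Variables (k M : nat) (A : {set 'I_M}).
Let c (e : {set 'I_M}) := e \subset A.

Lemma red_copy_inside (X : hypergraph k) :
  no_isolated_vertex X -> contains_copy (color_class k c true) X -> #|X| <= #|A|.
Proof.
move=> /forallP nX [f fI fe].
rewrite -cardsT -(card_imset _ fI); apply/subset_leq_card/subsetP.
move=> _ /imsetP [x _ ->]; have /exists_inP [e eX xe] := nX x.
have := fe e eX; rewrite inE => /andP [_ /eqP ceA].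
by apply: (subsetP ceA); apply: imset_f.
Qed.

Lemma blue_copies_outside n (H : hypergraph k) :
  contains_copy (color_class k c false) (copies n H) ->
  n * (#|H| - alpha H) <= #|~: A|.
Proof.
case=> f fI fe.
(* The part of a blue copy lying in [A] is independent, since an edge inside [A] would be red. *)
have indep i : #|[set x | f (i, x) \in A]| <= alpha H.
  apply/leq_alpha/forall_inP => e eH; apply/negP => /subsetP se.
  have /fe : [set (i, x) | x in (e : {set H})] \in edges (copies n H).
    by apply/imset2P; exists i e.
  rewrite inE => /andP [_ /eqP /negbT /negP []].
  apply/subsetP => _ /imsetP [_ /imsetP [x xe ->] ->].
  by have := se x xe; rewrite inE.
have outside i : #|H| - alpha H <= \sum_(x | f (i, x) \notin A) 1.
  rewrite sum1_card leq_subLR -(cardsC [set x | f (i, x) \in A]).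
  apply: leq_add => //; apply: subset_leq_card; apply/subsetP => x.
  by rewrite !inE.
rewrite -{1}(card_ord n) -sum_nat_const.
apply: leq_trans (leq_sum _ (fun i _ => outside i)) _.
(* The double sum counts the pairs sent outside [A], and [f] injects these into the complement. *)
rewrite pair_big_dep /= sum1_card -(card_imset _ fI).
apply/subset_leq_card/subsetP => _ /imsetP [[i x] ix ->].
by rewrite inE.
Qed.

End LowerBound.

Lemma arrows_copies_lower k m n M (G H : hypergraph k) :
  no_isolated_vertex G -> 0 < m * #|G| -> 0 < n * (#|H| - alpha H) ->
  arrows M (copies m G) (copies n H) ->
  m * #|G| + n * (#|H| - alpha H) <= M.+1.
Proof.
move=> nG G0 H0 aM.
(* The minimum covers small [M]: then [A] is everything, and no vertex is left outside for a blue
   copy. *)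
have [|A [_ _ cA]] := @extend_card _ set0 [set: 'I_M] (minn (m * #|G|).-1 M) (sub0set _).
  by rewrite cards0 cardsT card_ord geq_minr.
have cCA := cardsC A; rewrite cA card_ord in cCA.
case: (aM (fun e => e \subset A)).
- move/(red_copy_inside (copies_no_isolated_vertex _ nG)).
  by rewrite card_prod card_ord cA; lia.
- by move/blue_copies_outside; lia.
Qed.

Theorem theorem3p4 (k m n : nat) (G H : hypergraph k)
  (hk : 2 <= k) (hn : 1 <= n) (hmn : n <= m)
  (G_no_isolated : no_isolated_vertex G) (H_has_edge : edges H != set0)
  (halpha : alpha H <= alpha G)
  (hR : is_ramsey_number G H (#|G| + #|H| - alpha H - 1)) :
  is_ramsey_number (copies m G) (copies n H)
    (m * #|G| + n * #|H| - n * alpha H - 1).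
Proof.
case: n hn hmn => // {}n _; case: m => // {}m nm.
have dH := alpha_ltn_card (ltnW hk) H_has_edge.
have aH := alpha_gt0 hk H_has_edge.
have aG : alpha H < #|G|.
  apply: (leq_ltn_trans halpha); apply: alpha_ltn_card; first exact: ltnW.
  (* [G] has a vertex because [alpha G >= alpha H > 0], and that vertex lies on an edge; so
     [alpha G < #|G|]. *)
  have /card_gt0P [x _] : 0 < #|G|.
    apply: leq_trans (leq_trans aH halpha) _.
    by apply/bigmax_leqP => A _; apply: max_card.
  have /exists_inP [e eG _] := forallP G_no_isolated x.
  by apply/set0Pn; exists e.
pose d := #|H| - alpha H.
have cH : #|H| = alpha H + d by rewrite /d subnKC // ltnW.
have d0 : 0 < d by rewrite /d subn_gt0.
have -> : m.+1 * #|G| + n.+1 * #|H| - n.+1 * alpha H - 1 = (m.+1 * #|G| + n.+1 * d).-1.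
  by rewrite cH mulnDr; lia.
have mG : 1 < m.+1 * #|G| by apply: leq_trans (leq_pmull _ _); lia.
have nd : 0 < n.+1 * d by rewrite muln_gt0.
have {hR} [_ aR _] := hR.
have {}aR : arrows (#|G| + d).-1 G H.
  by move: aR; rewrite (_ : _ - _ - 1 = (#|G| + d).-1) //; lia.
split=> [||M _ aM]; first by lia.
- move=> c.
  have /orP [/contains_copy_mono|/contains_copy_mono] :
      mono_copy c true (copies m.+1 G) setT || mono_copy c false (copies n.+1 H) setT.
  + by apply: (arrows_copies cH d0 aG aR); rewrite // cardsT card_ord; lia.
  + by left.
  + by right.
- have := arrows_copies_lower G_no_isolated (ltnW mG) nd aM; rewrite -/d; lia.
Qed.
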